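(* Let $1\le p\le q$ be integers, $n=p+q$, and let $\lambda=(\lambda_1,\dots,\lambda_p\,|\,\lambda_{p+1},\dots,\lambda_n)\in\mathbb{R}^n$ satisfy $\lambda_1\ge\dots\ge\lambda_p$, $\lambda_{p+1}\ge\dots\ge\lambda_n$, and $\lambda_i-\lambda_j\in\mathbb{Z}$ whenever $i,j\in\{1,\dots,p\}$ or $i,j\in\{p+1,\dots,n\}$. Let $p'\le p$ and $q'\le q$ be the maximal positive integers such that $\lambda_1=\dots=\lambda_{p'}$ and $\lambda_{n-q'+1}=\dots=\lambda_n$, so that $$\lambda=(\underbrace{\lambda_1,\dots,\lambda_1}_{p'},\lambda_{p'+1},\dots,\lambda_p\,|\,\lambda_{p+1},\dots,\lambda_{n-q'},\underbrace{\lambda_n,\dots,\lambda_n}_{q'}).$$ Then: (1) If for some integer $i\in[1,\min(p',q')]$ $$\lambda_1-\lambda_n<-n+p'+q'-i+1,$$ then $$\|(\lambda-s)^++\rho\|^2>\|\lambda+\rho\|^2$$ for every nonzero Schmid module $s=(b_1,\dots,b_j,0,\dots,0\,|\,0,\dots,0,-b_j,\dots,-b_1)$ with $j\le i$. (2) If $$\lambda_1-\lambda_n<-n+p'+q'-\min(p',q')+1=-n+\max(p',q')+1,$$ then $\|(\lambda-s)^++\rho\|^2>\|\lambda+\rho\|^2$ for every nonzero Schmid module $s$.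
   Context: This is the case $\mathfrak{g}_0=\mathfrak{su}(p,q)$, $p\le q$, $n=p+q$. Here $\rho=\frac12(n-1,n-3,\dots,-n+3,-n+1)\in\mathbb{R}^n$ and $\|\cdot\|$ is the standard Euclidean norm on $\mathbb{R}^n$. The bar separates the first $p$ coordinates from the last $q$ coordinates. The Weyl group $W_{\mathfrak{k}}=S_p\times S_q$ acts by permuting the first $p$ coordinates among themselves and the last $q$ coordinates among themselves; for $\mu\in\mathbb{R}^n$, $\mu^+$ denotes the unique $W_{\mathfrak{k}}$-conjugate of $\mu$ with $\mu_1\ge\dots\ge\mu_p$ and $\mu_{p+1}\ge\dots\ge\mu_n$. A Schmid module is identified with an $n$-tuple $s=(b_1,\dots,b_p\,|\,0,\dots,0,-b_p,\dots,-b_1)$ with integers $b_1\ge\dots\ge b_p\ge 0$. *)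

(* Defs.v *)
From HB Require Import structures.
From mathcomp Require Import all_boot all_order all_algebra all_fingroup.
From mathcomp Require Import reals.

Set Implicit Arguments.
Unset Strict Implicit.
Unset Printing Implicit Defensive.

Import Order.TTheory GRing.Theory Num.Theory.
Local Open Scope ring_scope.

(* A vector (x_1, ..., x_p | x_{p+1}, ..., x_{p+q}) is a row x of width p + q;
   indices are 0-based, so x_{i+1} is x 0 (lshift q i) for i : 'I_p, and
   x_{p+j+1} is x 0 (rshift p j) for j : 'I_q. *)

Section Vectors.
Variables (R : realType) (p q : nat).
Implicit Types (x : 'rV[R]_(p + q)) (w : {perm 'I_p} * {perm 'I_q}).

(* x_1 *)
Definition fst_coord (hp : (0 < p)%N) x : R := x 0 (lshift q (Ordinal hp)).

(* x_{p+q} *)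
Definition lst_coord (hq : (0 < q)%N) x : R :=
  x 0 (rshift p (rev_ord (Ordinal hq))).

Definition kdominant x : bool :=
  [forall i : 'I_p, forall j : 'I_p,
     (i <= j)%N ==> (x 0 (lshift q j) <= x 0 (lshift q i))] &&
  [forall i : 'I_q, forall j : 'I_q,
     (i <= j)%N ==> (x 0 (rshift p j) <= x 0 (rshift p i))].

Definition kintegral x : Prop :=
  (forall i j : 'I_p, x 0 (lshift q i) - x 0 (lshift q j) \is a Num.int) /\
  (forall i j : 'I_q, x 0 (rshift p i) - x 0 (rshift p j) \is a Num.int).

(* x_1 = ... = x_m (used for m <= p) *)
Definition head_const x (m : nat) : Prop :=
  forall i j : 'I_p, (i < m)%N -> (j < m)%N ->
    x 0 (lshift q i) = x 0 (lshift q j).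

(* x_{n-m+1} = ... = x_n, n = p + q (used for m <= q) *)
Definition tail_const x (m : nat) : Prop :=
  forall i j : 'I_q, (q - m <= i)%N -> (q - m <= j)%N ->
    x 0 (rshift p i) = x 0 (rshift p j).

Definition max_head x (p' : nat) : Prop :=
  [/\ (0 < p')%N, (p' <= p)%N, head_const x p' &
      forall m, (m <= p)%N -> head_const x m -> (m <= p')%N].

Definition max_tail x (q' : nat) : Prop :=
  [/\ (0 < q')%N, (q' <= q)%N, tail_const x q' &
      forall m, (m <= q)%N -> tail_const x m -> (m <= q')%N].

Definition weylk_act w x : 'rV[R]_(p + q) :=
  row_mx (col_perm w.1 (lsubmx x)) (col_perm w.2 (rsubmx x)).

(* x^+; the default value of odflt is never used, and the result does not
   depend on the choice of w: see kdominant_dom_conj and dom_conj_uniq. *)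
Definition dom_conj x : 'rV[R]_(p + q) :=
  weylk_act (odflt (1%g, 1%g) [pick w | kdominant (weylk_act w x)]) x.

End Vectors.

Definition rho (R : realType) (n : nat) : 'rV[R]_n :=
  \row_(k < n) ((n%:R - 1 - 2 * k%:R) / 2).

Definition enorm (R : realType) (n : nat) (x : 'rV[R]_n) : R :=
  Num.sqrt (\sum_(k < n) x 0 k ^+ 2).

(* b_1 >= ... >= b_p >= 0 *)
Definition schmid_param (p : nat) (b : 'rV[int]_p) : Prop :=
  (forall i j : 'I_p, (i <= j)%N -> b 0 j <= b 0 i) /\
  (forall i : 'I_p, 0 <= b 0 i).

(* (b_1, ..., b_p | 0, ..., 0, - b_p, ..., - b_1), meant for p <= q:
   rev_ord j is the distance of the j-th entry of the right block from its
   right end. *)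
Definition schmid (R : realType) (p q : nat) (b : 'rV[int]_p) :
    'rV[R]_(p + q) :=
  map_mx intr (row_mx b
    (\row_(j < q) if insub (rev_ord j : nat) is Some k then - b 0 k else 0)).

Section DomConj.
Variables (R : realType) (p q : nat).
Implicit Types (x : 'rV[R]_(p + q)) (w : {perm 'I_p} * {perm 'I_q}).

Let decr m (y : 'rV[R]_m) := forall i j : 'I_m, (i <= j)%N -> y 0 j <= y 0 i.

Let kdominantP x : reflect (decr (lsubmx x) /\ decr (rsubmx x)) (kdominant x).
Proof.
apply: (iffP andP) => -[Hl Hr]; split.
- by move=> i j ij; rewrite !mxE; move/forallP/(_ i)/forallP/(_ j)/implyP: Hl; exact.
- by move=> i j ij; rewrite !mxE; move/forallP/(_ i)/forallP/(_ j)/implyP: Hr; exact.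
- apply/forallP=> i; apply/forallP=> j; apply/implyP=> ij.
  by have := Hl i j ij; rewrite !mxE.
- apply/forallP=> i; apply/forallP=> j; apply/implyP=> ij.
  by have := Hr i j ij; rewrite !mxE.
Qed.

Let entries m (y : 'rV[R]_m) := [tuple y 0 i | i < m].

Let decr_sorted m (y : 'rV[R]_m) : decr y -> sorted >=%O (entries y).
Proof.
move=> Hy; case: m y Hy => [|m] y Hy; first by rewrite tuple0.
apply/(sortedP 0) => i; rewrite size_tuple => im.
have im' := ltnW im.
rewrite -[i]/(val (Ordinal im')) -[(val _).+1]/(val (Ordinal im)) /=.
rewrite -[X in _ <= X](tnth_nth 0 (entries y) (Ordinal im')).
rewrite -[X in X <= _](tnth_nth 0 (entries y) (Ordinal im)).
by rewrite !tnth_mktuple; apply: Hy.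
Qed.

Let sort_perm m (y : 'rV[R]_m) : exists s : {perm 'I_m}, decr (col_perm s y).
Proof.
have st : size (sort >=%O (entries y)) == m by rewrite size_sort size_tuple.
pose t := Tuple st.
have /tuple_permP[s Es] : perm_eq t (entries y) by rewrite perm_sort.
exists s => i j ij; rewrite !mxE.
have E k : y 0 (s k) = nth 0 t k.
  by rewrite Es -tnth_nth !tnth_mktuple.
rewrite !E.
have srt : sorted >=%O t by apply: sort_sorted => a b; exact: le_total.
have tr : transitive (>=%O : rel R) by move=> a b c ab bc; exact: le_trans bc ab.
have rf : reflexive (>=%O : rel R) by move=> a; exact: lexx.
have lt_t (k : 'I_m) : (k < size t)%N by rewrite size_tuple.
by have H := sorted_leq_nth tr rf 0 srt; apply: (H i j) => //; exact: lt_t.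
Qed.

Let decr_uniq m (y : 'rV[R]_m) (s t : {perm 'I_m}) :
  decr (col_perm s y) -> decr (col_perm t y) -> col_perm s y = col_perm t y.
Proof.
move=> /decr_sorted Hs /decr_sorted Ht.
have P (u : {perm 'I_m}) : perm_eq (entries (col_perm u y)) (entries y).
  apply/tuple_permP; exists u; congr (val _); apply: eq_from_tnth => i.
  by rewrite !tnth_mktuple mxE.
have E : val (entries (col_perm s y)) = val (entries (col_perm t y)).
  apply: (sorted_eq (leT := >=%O)) => //.
  - by move=> a b c ab bc; exact: le_trans bc ab.
  - by move=> a b /andP[ab ba]; apply/le_anti/andP.
  - by rewrite (permPl (P s)) perm_sym P.
apply/rowP => i; move/val_inj: E => /(congr1 (fun u => tnth u i)).
by rewrite !tnth_mktuple.
Qed.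

Lemma kdominant_dom_conj x : kdominant (dom_conj x).
Proof.
rewrite /dom_conj; case: pickP => //= none.
have [s Hs] := sort_perm (lsubmx x); have [t Ht] := sort_perm (rsubmx x).
have /kdominantP[] := none (s, t).
by rewrite /weylk_act row_mxKl row_mxKr.
Qed.

Lemma dom_conj_uniq x w :
  kdominant (weylk_act w x) -> weylk_act w x = dom_conj x.
Proof.
move/kdominantP; have /kdominantP := kdominant_dom_conj x.
rewrite /dom_conj /weylk_act; set v := odflt _ _.
rewrite !row_mxKl !row_mxKr => -[vl vr] [wl wr].
by rewrite (decr_uniq wl vl) (decr_uniq wr vr).
Qed.

End DomConj.

(* Main.v *)
Require Import Defs.
From HB Require Import structures.
From mathcomp Require Import all_boot all_order all_algebra all_fingroup.
From mathcomp Require Import reals.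
From mathcomp Require Import ring lra zify.

Set Implicit Arguments.
Unset Strict Implicit.
Unset Printing Implicit Defensive.

Import Order.TTheory GRing.Theory Num.Theory.
Local Open Scope ring_scope.

(** The left-hand norm is the norm at [s = 0], so the theorem bounds below the
    growth of the norm when [s] is subtracted. As the norm of [lam - s] is not
    changed by conjugation, the growth is
    [dot s s - 2 * dot lam s + 2 * (dot (lam - s)^+ rho - dot lam rho)]. The
    conjugate [(lam - s)^+] pairs maximally with [rho] among all conjugates
    ([dot_dom_conj]), so it may be replaced by any conjugate [w (lam - s)]; the
    freedom in [w] is the heart of the proof. If [w] fixes [lam], the pairings
    of [lam] with [rho] cancel and half the growth is at least
<<
      sum_k b_k (b_k - (lam_k - lam_{n-1-k}) + sigma k + tau k + 1 - n)
>>
    with 0-based indices, where [sigma k] is the position to which [w] moves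
    the [k]-th entry of [s], and [tau k] the distance from the right end to
    which it moves the [k]-th entry of [s] from the right
    ([enorm_schmid_growth]). By dominance, [lam_k - lam_{n-1-k}] is at most
    [D = lam_1 - lam_n] of the statement. The entries of [lam] are constant on
    the first [p'] and on the last [q'] positions, so [w] may permute each of
    these two groups freely.

    (1) Reverse both of these groups, so that [sigma k = p' - 1 - k] and
    [tau k = q' - 1 - k] for all [k < i]. The coefficient of [b_k] is then at
    least [(b_k - 1) + (i - 1 - 2 k) + e], with
    [e = - n + p' + q' - i + 1 - D > 0]. The first part contributes at least 0
    because a nonzero integer [b_k >= 0] is at least 1, the second because [b]
    is antitone and the weights [i - 1 - 2 k] are decreasing of sum 0
    (Chebyshev), and the third is positive because [s] is not 0.

    (2) Reverse only the longer of the two groups. Then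
    [sigma k + tau k + 1 >= max(p', q')] for every [k], with equality inside
    that group, and the coefficient of [b_k] is at least [(b_k - 1) + e], with
    [e = - n + max(p', q') + 1 - D > 0]. *)

Lemma natr_subS (R : realType) (m k : nat) :
  (k < m)%N -> (m - k.+1)%:R = m%:R - k%:R - 1 :> R.
Proof. by move=> km; rewrite natrB // -natr1; ring. Qed.

(** * Rearrangement *)

Lemma sum_tperm_gt (R : realType) (m : nat) (y c : 'I_m -> R) (i j : 'I_m) :
  c j < c i -> y i < y j ->
  \sum_k y k * c k < \sum_k y (tperm i j k) * c k.
Proof.
move=> cij yij.
have ji : j != i by apply: contraTneq yij => ->; rewrite ltxx.
rewrite [ltLHS](bigD1 i) //= [in ltLHS](bigD1 j) //=.
rewrite [ltRHS](bigD1 i) //= [in ltRHS](bigD1 j) //=.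
rewrite tpermL tpermR.
rewrite [in ltRHS](eq_bigr (fun k => y k * c k)); last first.
  by move=> k /andP[ki kj]; rewrite tpermD // eq_sym.
set S := \sum_(_ | _) _; nra.
Qed.

(** A permutation maximising the pairing with a strictly decreasing sequence
    sorts [y]: otherwise exchanging two entries that are out of order would
    increase the pairing. Taking a maximiser gives the rearrangement inequality
    and the sortedness at once. *)
Lemma antitone_perm_max (R : realType) (m : nat) (y c : 'I_m -> R) :
  (forall i j : 'I_m, (i < j)%N -> c j < c i) ->
  exists2 s : 'S_m, forall i j : 'I_m, (i <= j)%N -> y (s j) <= y (s i) &
    forall t : 'S_m, \sum_k y (t k) * c k <= \sum_k y (s k) * c k.
Proof.
move=> c_decr.
case: (@Order.TotalTheory.arg_maxP _ R _ 1%g predT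
  (fun t : 'S_m => \sum_k y (t k) * c k)) => // s _ s_max.
exists s => [i j|t]; last exact: s_max.
rewrite leq_eqVlt => /predU1P[/val_inj->//|/c_decr cij].
rewrite leNgt; apply/negP => /(@sum_tperm_gt R m (y \o s) c _ _ cij).
apply/negP; rewrite -leNgt; apply: le_trans (s_max (tperm i j * s)%g isT).
by apply: ler_sum => k _; rewrite permM.
Qed.

(** * Norms of dominant conjugates *)

Section Euclidean.
Variables (R : realType) (n : nat).
Implicit Types x y : 'rV[R]_n.

Definition dot x y : R := \sum_k x 0 k * y 0 k.

Lemma enorm_sqr x : enorm x ^+ 2 = dot x x.
Proof.
rewrite sqr_sqrtr; last by apply: sumr_ge0 => k _; exact: sqr_ge0.
by apply: eq_bigr => k _; rewrite expr2.
Qed.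

Lemma dotBl x y z : dot (x - y) z = dot x z - dot y z.
Proof. by rewrite -sumrB; apply: eq_bigr => k _; rewrite !mxE mulrBl. Qed.

Lemma dot_sqrD x y : dot (x + y) (x + y) = dot x x + 2 * dot x y + dot y y.
Proof.
by rewrite mulr_sumr -!big_split; apply: eq_bigr => k _; rewrite !mxE /=; ring.
Qed.

Lemma dot_sqrB x y : dot (x - y) (x - y) = dot x x - 2 * dot x y + dot y y.
Proof.
rewrite mulr_sumr -sumrB -big_split.
by apply: eq_bigr => k _; rewrite !mxE /=; ring.
Qed.

End Euclidean.

Section WeylGroup.
Variables (R : realType) (p q : nat).
Implicit Types (x y : 'rV[R]_(p + q)) (w : {perm 'I_p} * {perm 'I_q}).

Lemma dot_split x y :
  dot x y = \sum_k x 0 (lshift q k) * y 0 (lshift q k)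
          + \sum_k x 0 (rshift p k) * y 0 (rshift p k).
Proof. exact: big_split_ord. Qed.

Lemma weylk_actL w x k : weylk_act w x 0 (lshift q k) = x 0 (lshift q (w.1 k)).
Proof. by rewrite /weylk_act row_mxEl !mxE. Qed.

Lemma weylk_actR w x k : weylk_act w x 0 (rshift p k) = x 0 (rshift p (w.2 k)).
Proof. by rewrite /weylk_act row_mxEr !mxE. Qed.

Lemma weylk_actB w x y : weylk_act w (x - y) = weylk_act w x - weylk_act w y.
Proof.
apply/rowP => k; rewrite -(splitK k).
by case: split => j; rewrite /= !(weylk_actL, weylk_actR, mxE).
Qed.

Lemma dot_weylk_act w x : dot (weylk_act w x) (weylk_act w x) = dot x x.
Proof.
rewrite !dot_split; congr (_ + _).
  by rewrite [RHS](reindex_perm w.1); apply: eq_bigr => k _; rewrite weylk_actL.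
by rewrite [RHS](reindex_perm w.2); apply: eq_bigr => k _; rewrite weylk_actR.
Qed.

Lemma rhoL (k : 'I_p) :
  rho R (p + q) 0 (lshift q k) = ((p + q)%:R - 1 - 2 * k%:R) / 2.
Proof. by rewrite mxE. Qed.

Lemma rhoR (k : 'I_q) :
  rho R (p + q) 0 (rshift p k) = ((p + q)%:R - 1 - 2 * (p + k)%:R) / 2.
Proof. by rewrite mxE. Qed.

(** The maximisers found separately in the two blocks form a dominant conjugate
    of [x], which is [x^+] by uniqueness. *)
Lemma dot_dom_conj w x :
  dot (weylk_act w x) (rho R (p + q)) <= dot (dom_conj x) (rho R (p + q)).
Proof.
have [|s s_decr s_max] := @antitone_perm_max R p (fun k => x 0 (lshift q k))
    (fun k => rho R (p + q) 0 (lshift q k)).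
  by move=> i j; rewrite -(ltr_nat R) !rhoL; lra.
have [|t t_decr t_max] := @antitone_perm_max R q (fun k => x 0 (rshift p k))
    (fun k => rho R (p + q) 0 (rshift p k)).
  by move=> i j; rewrite -(ltr_nat R) !rhoR !natrD; lra.
rewrite -(@dom_conj_uniq _ _ _ x (s, t)).
  rewrite !dot_split.
  under eq_bigr do rewrite weylk_actL.
  under [X in _ + X]eq_bigr do rewrite weylk_actR.
  under [X in _ <= X + _]eq_bigr do rewrite weylk_actL.
  under [X in _ <= _ + X]eq_bigr do rewrite weylk_actR.
  exact: lerD (s_max w.1) (t_max w.2).
apply/andP; split; apply/forallP => i; apply/forallP => j; apply/implyP => ij.
  by rewrite !weylk_actL s_decr.
by rewrite !weylk_actR t_decr.
Qed.

(** Because [w] fixes [x], the pairing of [w (x - s)] with [rho] differs from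
    that of [x] only by that of [w s], so [x] survives in the bound only through
    [dot x s]. *)
Lemma enorm_dom_conj_sub_ge w x s : weylk_act w x = x ->
  dot s s - 2 * dot x s - 2 * dot (weylk_act w s) (rho R (p + q)) <=
  enorm (dom_conj (x - s) + rho R (p + q)) ^+ 2
  - enorm (x + rho R (p + q)) ^+ 2.
Proof.
move=> wx; have := dot_dom_conj w (x - s).
rewrite weylk_actB wx dotBl !enorm_sqr !dot_sqrD.
rewrite [dot (dom_conj _) (dom_conj _)]dot_weylk_act dot_sqrB; lra.
Qed.

End WeylGroup.

(** * Growth of the norm along a Schmid module *)

Section Schmid.
Variables (R : realType) (p q : nat) (hpq : (p <= q)%N).
Implicit Types (lam : 'rV[R]_(p + q)) (b : 'rV[int]_p).

Definition mirror (k : 'I_p) : 'I_q := rev_ord (widen_ord hpq k).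

(** The right block of a Schmid module is supported on the mirror images of the
    left positions; the general [g] covers every sum over that block that occurs
    below. *)
Lemma sum_schmidR b (g : R -> 'I_q -> R) : (forall j, g 0 j = 0) ->
  \sum_j g (schmid R q b 0 (rshift p j)) j =
  \sum_k g (- (b 0 k)%:~R) (mirror k).
Proof.
move=> g0; rewrite (reindex_inj rev_ord_inj) /=.
rewrite (bigID (fun j : 'I_q => (j < p)%N)) /=.
rewrite [X in _ + X]big1 ?addr0.
  rewrite (big_ord_narrow hpq) /=; apply: eq_bigr => k _.
  rewrite /schmid mxE row_mxEr mxE rev_ordK.
  by rewrite (valK k : insub (widen_ord hpq k : nat) = Some k) mulrNz.
by move=> j jp; rewrite /schmid mxE row_mxEr mxE rev_ordK insubN // g0.
Qed.

Lemma schmidL b k : schmid R q b 0 (lshift q k) = (b 0 k)%:~R.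
Proof. by rewrite mxE row_mxEl. Qed.

(** The permutations are indexed by the entries of [s] and give the positions to
    which these move, hence the inverses in the Weyl group element; [tau] counts
    positions from the right end, which is where the right block of [s] starts.
    The constant [1 - n] comes from
    [- rho_{sigma k} + rho_{n-1-tau k} = sigma k + tau k + 1 - n]. *)
Lemma enorm_schmid_growth lam b (sigma : 'S_p) (tau : 'S_q) :
  (forall k, lam 0 (lshift q (sigma k)) = lam 0 (lshift q k)) ->
  (forall k, lam 0 (rshift p (rev_ord (tau k))) =
             lam 0 (rshift p (rev_ord k))) ->
  2 * \sum_k (b 0 k)%:~R *
      ((b 0 k)%:~R - (lam 0 (lshift q k) - lam 0 (rshift p (mirror k)))
       + (sigma k)%:R + (tau (widen_ord hpq k))%:R + 1 - (p + q)%:R) <=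
  enorm (dom_conj (lam - schmid R q b) + rho R (p + q)) ^+ 2
  - enorm (lam + rho R (p + q)) ^+ 2.
Proof.
move=> lam_sigma lam_tau.
have t_inj := inj_comp (@rev_ord_inj q)
  (inj_comp (@perm_inj _ tau) (@rev_ord_inj q)).
pose t := perm t_inj.
have tE j : t j = rev_ord (tau (rev_ord j)) by rewrite permE.
pose w := (sigma^-1, t^-1)%g.
have wlam : weylk_act w lam = lam.
  apply/rowP => k; rewrite -(splitK k); case: split => j /=.
    by rewrite weylk_actL -[in RHS](permKV sigma j) lam_sigma.
  by rewrite weylk_actR -[in RHS](permKV t j) tE lam_tau rev_ordK.
apply: le_trans (enorm_dom_conj_sub_ge (schmid R q b) wlam).
rewrite !dot_split.
rewrite [X in _ - 2 * (X + _)](reindex_perm sigma).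
rewrite [X in _ - 2 * (_ + X)](reindex_perm t).
under [X in _ - 2 * (_ + X)]eq_bigr do rewrite weylk_actR permK.
under [X in _ - 2 * (X + _)]eq_bigr do rewrite weylk_actL permK.
rewrite (sum_schmidR b (g := fun a _ => a * a)) => [|j]; last by rewrite mul0r.
rewrite (sum_schmidR b (g := fun a j => lam 0 (rshift p j) * a)) => [|j];
  last by rewrite mulr0.
rewrite (sum_schmidR b
  (g := fun a j => a * rho R (p + q) 0 (rshift p (t j)))) => [|j];
  last by rewrite mul0r.
rewrite -!big_split /= !mulr_sumr -!sumrB; apply: ler_sum => k _.
rewrite !schmidL rhoL rhoR tE rev_ordK !natrD.
rewrite [in (rev_ord _)%:R]/= natr_subS //.
by rewrite le_eqVlt; apply/orP; left; apply/eqP; field.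
Qed.

End Schmid.

(** * Positivity of the growth *)

(** Chebyshev's sum inequality against weights of sum 0: adding the sum to its
    reversal gives the terms [(x k - x (m-1-k)) * (m-1-2k)], whose two factors
    have the same sign. *)
Lemma sum_antitone_centred_ge0 (R : realType) (m : nat) (x : 'I_m -> R) :
  (forall i j : 'I_m, (i <= j)%N -> x j <= x i) ->
  0 <= \sum_k x k * (m%:R - 1 - 2 * k%:R).
Proof.
move=> x_decr; set S := \sum_k _.
suff : 0 <= S + S by lra.
rewrite {2}/S (reindex_inj rev_ord_inj) /= -big_split /=.
apply: sumr_ge0 => k _; rewrite natr_subS //.
have [kr|rk] := leqP k (rev_ord k).
  have := x_decr _ _ kr.
  have : (k%:R <= (rev_ord k)%:R :> R) by rewrite ler_nat.
  rewrite /= natr_subS //; nra.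
have := x_decr _ _ (ltnW rk).
have : ((rev_ord k)%:R <= k%:R :> R) by rewrite ler_nat ltnW.
rewrite /= natr_subS //; nra.
Qed.

(** A nonzero [b_k] is at least 1, so the part [b_k - 1] of the coefficient
    never contributes negatively; [e] stands for the slack in the hypothesis on
    the weight, and [d] for the part of the coefficient that is controlled only
    after summation. *)
Lemma schmid_sum_gt0 (R : realType) (p : nat) (b : 'rV[int]_p)
    (e : R) (c d : 'I_p -> R) :
  (forall k, 0 <= b 0 k) -> b != 0 -> 0 < e ->
  (forall k, b 0 k != 0 -> (b 0 k)%:~R - 1 + e + d k <= c k) ->
  0 <= \sum_k (b 0 k)%:~R * d k ->
  0 < \sum_k (b 0 k)%:~R * c k.
Proof.
move=> b_ge0 b_neq0 e_gt0 c_ge d_ge0.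
have bR_ge0 k : 0 <= (b 0 k)%:~R :> R by rewrite ler0z.
have [k0 bk0] : exists k, b 0 k != 0.
  apply/existsP; apply: contraNT b_neq0; rewrite negb_exists => /forallP b0.
  by apply/eqP/rowP => k; rewrite mxE; apply/eqP; have := b0 k; rewrite negbK.
have sum_gt0 : 0 < \sum_k (b 0 k)%:~R * e.
  rewrite (bigD1 k0) //= ltr_wpDr //.
    by apply: sumr_ge0 => k _; rewrite mulr_ge0 // ltW.
  by rewrite mulr_gt0 // ltr0z lt_def bk0 b_ge0.
apply: lt_le_trans (_ : \sum_k (b 0 k)%:~R * (e + d k) <= _).
  under eq_bigr do rewrite mulrDr.
  by rewrite big_split /= ltr_wpDr.
apply: ler_sum => k _.
have [->|bk] := eqVneq (b 0 k) 0; first by rewrite !mul0r.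
have b_ge1 : 1 <= (b 0 k)%:~R :> R.
  by rewrite ler1z -gtz0_ge1 lt_def bk b_ge0.
by rewrite ler_wpM2l //; have := c_ge k bk; lra.
Qed.

(** * Permutations preserving the weight *)

Lemma prefix_reversal (m a : nat) : (a <= m)%N ->
  exists s : 'S_m,
    forall k : 'I_m, s k = (if k < a then a.-1 - k else k)%N :> nat.
Proof.
move=> am.
have lt_m (k : 'I_m) : ((if k < a then a.-1 - k else k) < m)%N.
  by case: ifP => ka //; have := ltn_ord k; lia.
pose f k : 'I_m := Ordinal (lt_m k).
have f_inj : injective f.
  move=> k l /(congr1 val) /=.
  by do 2 case: ifP => ?; move=> ?; apply: val_inj => /=; lia.
by exists (perm f_inj) => k; rewrite permE.
Qed.

Section Stabilisers.
Variables (R : realType) (p q : nat) (lam : 'rV[R]_(p + q)).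

Lemma head_reversal (a : nat) : (a <= p)%N -> head_const lam a ->
  exists2 s : 'S_p,
    forall k : 'I_p, s k = (if k < a then a.-1 - k else k)%N :> nat &
    forall k, lam 0 (lshift q (s k)) = lam 0 (lshift q k).
Proof.
move=> ap lam_const; have [s sE] := prefix_reversal ap.
exists s => // k; have := sE k.
case: ifP => ka sk; last by rewrite (val_inj sk).
by apply: lam_const => //; rewrite sk; lia.
Qed.

(** Counted from the right end, as everywhere for the right block, the last [a]
    positions are the first [a] ones, so the same reversal applies. *)
Lemma tail_reversal (a : nat) : (a <= q)%N -> tail_const lam a ->
  exists2 s : 'S_q,
    forall k : 'I_q, s k = (if k < a then a.-1 - k else k)%N :> nat &
    forall k, lam 0 (rshift p (rev_ord (s k))) =
              lam 0 (rshift p (rev_ord k)).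
Proof.
move=> aq lam_const; have [s sE] := prefix_reversal aq.
exists s => // k; have := sE k.
case: ifP => ka sk; last by rewrite (val_inj sk).
by apply: lam_const => /=; lia.
Qed.

Lemma kdominant_gap_le (hp : (0 < p)%N) (hq : (0 < q)%N) (i : 'I_p) (j : 'I_q) :
  kdominant lam ->
  lam 0 (lshift q i) - lam 0 (rshift p j) <=
  fst_coord hp lam - lst_coord hq lam.
Proof.
case/andP => /forallP/(_ (Ordinal hp))/forallP/(_ i)/implyP/(_ (leq0n i)) lei.
move=> /forallP/(_ j)/forallP/(_ (rev_ord (Ordinal hq)))/implyP lej.
by apply: lerB lei (lej _) => /=; have := ltn_ord j; lia.
Qed.

End Stabilisers.

(** * The norm inequalities *)

Lemma schmid0 (R : realType) (p q : nat) : schmid R q (0 : 'rV[int]_p) = 0.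
Proof.
apply/rowP => k; rewrite !mxE; case: split => j; rewrite !mxE //.
by case: insub => [k'|] //; rewrite mxE oppr0.
Qed.

(** The common reduction of both parts: it remains to choose permutations
    [sigma] and [tau] that preserve [lam], and weights [d]. *)
Lemma enorm_schmid_gt (R : realType) (p q : nat) (hp : (0 < p)%N)
    (hpq : (p <= q)%N) (lam : 'rV[R]_(p + q)) (b : 'rV[int]_p)
    (sigma : 'S_p) (tau : 'S_q) (e : R) (d : 'I_p -> R) :
  kdominant lam ->
  (forall k, lam 0 (lshift q (sigma k)) = lam 0 (lshift q k)) ->
  (forall k, lam 0 (rshift p (rev_ord (tau k))) =
             lam 0 (rshift p (rev_ord k))) ->
  schmid_param b -> schmid R q b != 0 -> 0 < e ->
  (forall k, b 0 k != 0 ->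
     e + d k <= (sigma k)%:R + (tau (widen_ord hpq k))%:R + 2 - (p + q)%:R
       - (fst_coord hp lam - lst_coord (leq_trans hp hpq) lam)) ->
  0 <= \sum_k (b 0 k)%:~R * d k ->
  enorm (lam + rho R (p + q)) ^+ 2
    < enorm (dom_conj (lam - schmid R q b) + rho R (p + q)) ^+ 2.
Proof.
move=> lam_dom sigma_lam tau_lam [_ b_ge0] s_neq0 e_gt0 d_le d_ge0.
have b_neq0 : b != 0 by apply: contraNneq s_neq0 => ->; rewrite schmid0.
rewrite -subr_gt0.
apply: lt_le_trans (enorm_schmid_growth hpq b sigma_lam tau_lam).
rewrite mulr_gt0 //.
apply: (schmid_sum_gt0 b_ge0 b_neq0 e_gt0 _ d_ge0) => k /d_le.
have := kdominant_gap_le hp (leq_trans hp hpq) k (mirror hpq k) lam_dom; lra.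
Qed.

Theorem theorem3p47 (R : realType) (p q : nat)
    (hp : (1 <= p)%N) (hpq : (p <= q)%N)
    (lam : 'rV[R]_(p + q))
    (lam_dom : kdominant lam) (lam_int : kintegral lam)
    (p' q' : nat) (hp' : max_head lam p') (hq' : max_tail lam q') :
  let n := (p + q)%N in
  let lam1 := fst_coord hp lam in
  let lamn := lst_coord (leq_trans hp hpq) lam in
  (forall i : nat, (1 <= i <= minn p' q')%N ->
     lam1 - lamn < - n%:R + p'%:R + q'%:R - i%:R + 1 ->
     forall (j : nat) (b : 'rV[int]_p), (j <= i)%N ->
       schmid_param b -> (forall k : 'I_p, (j <= k)%N -> b 0 k = 0) ->
       schmid R q b != 0 ->
       enorm (lam + rho R n) ^+ 2
         < enorm (dom_conj (lam - schmid R q b) + rho R n) ^+ 2)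
  /\
  (- n%:R + p'%:R + q'%:R - (minn p' q')%:R + 1
     = - n%:R + (maxn p' q')%:R + 1 :> R
   /\
   (lam1 - lamn < - n%:R + p'%:R + q'%:R - (minn p' q')%:R + 1 ->
    forall b : 'rV[int]_p,
      schmid_param b -> schmid R q b != 0 ->
      enorm (lam + rho R n) ^+ 2
        < enorm (dom_conj (lam - schmid R q b) + rho R n) ^+ 2)).
Proof.
move=> /=; set lam1 := fst_coord _ _; set lamn := lst_coord _ _.
have [p'_gt0 p'p head _] := hp'; have [q'_gt0 q'q tail _] := hq'.
have [rev_l rev_lE lam_l] := head_reversal p'p head.
have [rev_r rev_rE lam_r] := tail_reversal q'q tail.
have min_max : - (p + q)%:R + p'%:R + q'%:R - (minn p' q')%:R + 1
     = - (p + q)%:R + (maxn p' q')%:R + 1 :> R.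
  have : (minn p' q')%:R + (maxn p' q')%:R = p'%:R + q'%:R :> R.
    by rewrite -!natrD addn_min_max.
  lra.
split; last split => //.
  move=> i /andP[i_gt0]; rewrite leq_min => /andP[ip' iq'].
  move=> gap j b ji b_param b0 s_neq0.
  apply: (enorm_schmid_gt (hp := hp) (hpq := hpq)
            (sigma := rev_l) (tau := rev_r)
            (e := - (p + q)%:R + p'%:R + q'%:R - i%:R + 1 - (lam1 - lamn))
            (d := fun k => i%:R - 1 - 2 * k%:R)) => //.
  - by rewrite subr_gt0.
  - move=> k bk.
    have kj : (k < j)%N by rewrite ltnNge; apply: contraNN bk => /b0 ->.
    rewrite rev_lE rev_rE /=.
    have kp' : (k < p')%N by lia.
    have kq' : (k < q')%N by lia.
    rewrite kp' kq' -!subn1 -!subnDA !add1n !natr_subS //.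
    rewrite -/lam1 -/lamn; lra.
  - have ip : (i <= p)%N by lia.
    rewrite (bigID (fun k : 'I_p => (k < i)%N)) /= [X in _ + X]big1 ?addr0.
      rewrite (big_ord_narrow ip) /=; apply: (sum_antitone_centred_ge0
        (x := fun k => (b 0 (widen_ord ip k))%:~R)) => k l kl.
      by rewrite ler_int b_param.1.
    by move=> k; rewrite -leqNgt => ik; rewrite b0 ?mul0r //; lia.
rewrite min_max => gap b b_param s_neq0.
have gap_gt0 : 0 < - (p + q)%:R + (maxn p' q')%:R + 1 - (lam1 - lamn).
  by rewrite subr_gt0.
have sum0 : 0 <= \sum_k (b 0 k)%:~R * (0 : R).
  by rewrite big1 // => k _; rewrite mulr0.
have [p'q'|q'p'] := leqP p' q'.
  apply: (enorm_schmid_gt (sigma := 1%g) (tau := rev_r) (d := fun=> 0)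
    lam_dom _ _ b_param s_neq0 gap_gt0 _ sum0) => // [k|k _].
    by rewrite perm1.
  rewrite perm1 rev_rE /= (maxn_idPr p'q').
  have : (q' <= k + (if k < q' then q'.-1 - k else k) + 1)%N.
    by case: ifP => ?; lia.
  rewrite -(ler_nat R) -/lam1 -/lamn !natrD; lra.
apply: (enorm_schmid_gt (sigma := rev_l) (tau := 1%g) (d := fun=> 0)
  lam_dom _ _ b_param s_neq0 gap_gt0 _ sum0) => // [k|k _].
  by rewrite perm1.
rewrite perm1 rev_lE /= (maxn_idPl (ltnW q'p')).
have : (p' <= (if k < p' then p'.-1 - k else k) + k + 1)%N.
  by case: ifP => ?; lia.
rewrite -(ler_nat R) -/lam1 -/lamn !natrD; lra.
Qed.
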